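(* Let $m$ be a positive integer, and let $\alpha$ be a complex number. Then $$(-1)^{m}\frac{\pi^{2m+2}}{4(2m)!}\left((\alpha-1)^{2m}+(\alpha+1)^{2m}-2\alpha^{2m}\right)+\sum_{k=1}^m(-1)^k\left((\alpha-1)^{2k-1}-(\alpha+1)^{2k-1}\right)\frac{\pi^{2k}}{(2k-1)!}\,\lambda(2m-2k+2)=0.$$
   Context: The Dirichlet lambda function is $\lambda(s)=\sum_{n=0}^\infty\frac{1}{(2n+1)^s}$ for $\mathrm{Re}(s)>1$. *)

(* Defs.v *)
From Stdlib Require Import Reals.
From Coquelicot Require Import Coquelicot.

(* x ^ s = exp (s * ln x); meaningful for 0 < x only, since [ln] is 0 elsewhere. *)
Definition Rpos_Cpower (x : R) (s : C) : C :=
  ((exp (Re s * ln x) * cos (Im s * ln x))%R,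
   (exp (Re s * ln x) * sin (Im s * ln x))%R).

(* Total by way of [iota], like Coquelicot's [RInt]: the value is meaningful
   where the series converges, in particular for 1 < Re s. *)
Definition dirichlet_lambda (s : C) : C :=
  iota (T := C_CompleteNormedModule)
    (is_series (V := C_NormedModule)
       (fun n : nat => (1 / Rpos_Cpower (INR (2 * n + 1)) s)%C)).

(* Main.v *)
Require Import Defs.
From Stdlib Require Import Arith Reals Lra Lia.
From Coquelicot Require Import Coquelicot.

(** Write [a] for a general odd positive integer and [lambda_j] for
    [dirichlet_lambda (2 j + 2)], the sum of [1 / a ^ (2 j + 2)].

    The case [alpha = 0] of the identity is a linear recurrence between the
    [lambda_j] and powers of [PI] ([lambda_poly_PI]).  It comes from the Fourier
    series of the triangle wave: on [[0, PI]] the series of [cos (a x) / a ^ 2]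
    sums to [lambda_0 - PI x / 4].  Integrating this equality an odd number of
    times from [0] keeps a trigonometric series on one side, turns the other
    side into a polynomial whose coefficients are the [lambda_j], and yields
    the recurrence at [x = PI], where every [sin (a x)] vanishes.  To avoid all
    termwise manipulation of series, the integrations are carried out on
    partial sums: the error of the [N]-th partial sum of the triangle wave is
    uniformly small ([triangle_defect_uniformly_small]), each integration
    multiplies it by at most [PI] ([defects_le]), and only the final equality
    at [PI] is passed to the limit.

    The error estimate rests on the closed form of the Dirichlet kernel: the
    sum of the [cos (a x)] over the first [M] values of [a] is
    [sin (2 M x) / (2 sin x)].  It is the derivative of the partial sum of
    [sin (a x) / a], so the latter stays within [O (1 / (M sin x))] of its
    value at [PI / 2], which is a partial sum of the series of Leibniz for
    [PI / 4] ([sine_sum_estimate]).  Near [0] and [PI] a uniform bound is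
    enough, since one more integration follows ([sine_sum_bounded]).

    The passage from [alpha = 0] to an arbitrary complex [alpha] is formal.
    Expanding [(alpha + 1) ^ n] and [(alpha - 1) ^ n] by the binomial theorem
    turns the odd central differences and the even second differences into
    Cauchy products of the even divided powers of [alpha] with those of [1].
    The sum in the theorem then is a triple Cauchy product, and associativity
    lets the recurrence act on its last two factors
    ([lambda_polynomial_identity]). *)

Local Open Scope R_scope.

(** * Trigonometric sums over odd frequencies *)

Definition odd_number (n : nat) : R := INR (2 * n + 1).

Lemma odd_number_pos (n : nat) : 0 < odd_number n.
Proof. unfold odd_number. apply lt_0_INR. lia. Qed.

Lemma odd_number_eq (n : nat) : odd_number n = 2 * INR n + 1.
Proof. unfold odd_number. rewrite plus_INR, mult_INR. simpl. ring. Qed.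

Lemma odd_number_S (n : nat) : odd_number (S n) = odd_number n + 2.
Proof. rewrite !odd_number_eq, S_INR. ring. Qed.

Definition sine_sum (N : nat) (x : R) : R :=
  sum_n (fun n => sin (odd_number n * x) / odd_number n) N.

Definition dirichlet_kernel (N : nat) (x : R) : R :=
  sum_n (fun n => cos (odd_number n * x)) N.

Lemma is_derive_sine_sum (N : nat) (x : R) :
  is_derive (sine_sum N) x (dirichlet_kernel N x).
Proof.
  apply (is_derive_sum_n (K := R_AbsRing) (V := R_NormedModule)).
  intros k _. pose proof (odd_number_pos k). auto_derive; [lra | field; lra].
Qed.

(** Telescoping: [2 sin x cos (a x) = sin ((a + 1) x) - sin ((a - 1) x)]. *)
Lemma sin_mult_dirichlet_kernel (N : nat) (x : R) :
  2 * sin x * dirichlet_kernel N x = sin (2 * INR (S N) * x).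
Proof.
  unfold dirichlet_kernel. induction N as [|N IH].
  - rewrite sum_O. unfold odd_number. simpl.
    replace (2 * 1 * x) with (2 * x) by ring. rewrite sin_2a.
    replace (1 * x) with x by ring. ring.
  - rewrite sum_Sn. change (@plus _ ?a ?b) with (a + b).
    rewrite Rmult_plus_distr_l, IH.
    replace (2 * INR (S (S N)) * x) with (odd_number (S N) * x + x)
      by (rewrite odd_number_eq, (S_INR (S N)); ring).
    replace (2 * INR (S N) * x) with (odd_number (S N) * x - x)
      by (rewrite odd_number_eq; ring).
    rewrite sin_plus, sin_minus. ring.
Qed.

Lemma sin_odd_reflect (n : nat) (x : R) :
  sin (odd_number n * (PI - x)) = sin (odd_number n * x).
Proof.
  rewrite odd_number_eq.
  replace ((2 * INR n + 1) * (PI - x))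
    with (PI - ((2 * INR n + 1) * x) + 2 * INR n * PI) by ring.
  rewrite sin_period. apply sin_PI_x.
Qed.

Lemma sin_odd_PI (n : nat) : sin (odd_number n * PI) = 0.
Proof.
  rewrite <- (Rminus_0_r PI), sin_odd_reflect, Rmult_0_r. apply sin_0.
Qed.

Lemma sine_sum_reflect (N : nat) (x : R) :
  sine_sum N (PI - x) = sine_sum N x.
Proof.
  apply sum_n_ext. intros n. now rewrite sin_odd_reflect.
Qed.

(** Bounding by [sin x] instead of [x] keeps the estimate symmetric under
    [x -> PI - x], so that both ends of [[0, PI]] are covered at once. *)
Lemma Rabs_sin_odd_le (n : nat) (x : R) :
  Rabs (sin (odd_number n * x)) <= odd_number n * Rabs (sin x).
Proof.
  induction n as [|n IH].
  - unfold odd_number. simpl. rewrite !Rmult_1_l. lra.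
  - rewrite odd_number_S.
    replace ((odd_number n + 2) * x) with (odd_number n * x + 2 * x) by ring.
    rewrite sin_plus, sin_2a.
    eapply Rle_trans; [apply Rabs_triang|].
    rewrite !Rabs_mult, (Rabs_right 2) by lra.
    pose proof (Rabs_pos (sin (odd_number n * x))). pose proof (Rabs_pos (sin x)).
    assert (Hb : forall y, 0 <= Rabs (cos y) <= 1).
    { intros y. split; [apply Rabs_pos|].
      apply Rabs_le. pose proof (COS_bound y). lra. }
    pose proof (Hb (2 * x)). pose proof (Hb x). pose proof (Hb (odd_number n * x)).
    assert (Rabs (sin (odd_number n * x)) * Rabs (cos (2 * x))
              <= Rabs (sin (odd_number n * x)) * 1) by (apply Rmult_le_compat_l; lra).
    assert (Rabs (cos (odd_number n * x)) * (2 * Rabs (sin x) * Rabs (cos x))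
              <= 1 * (2 * Rabs (sin x) * 1)).
    { apply Rmult_le_compat; try lra.
      - apply Rmult_le_pos; lra.
      - apply Rmult_le_compat_l; lra. }
    lra.
Qed.

Lemma Rabs_sine_sum_le (N : nat) (x : R) :
  Rabs (sine_sum N x) <= INR (S N) * Rabs (sin x).
Proof.
  unfold sine_sum.
  assert (Ht : forall n, Rabs (sin (odd_number n * x) / odd_number n) <= Rabs (sin x)).
  { intros n. pose proof (odd_number_pos n). unfold Rdiv.
    rewrite Rabs_mult, (Rabs_right (/ odd_number n))
      by (apply Rle_ge, Rlt_le, Rinv_0_lt_compat; lra).
    apply Rle_div_l; [lra|]. rewrite (Rmult_comm (Rabs (sin x))). apply Rabs_sin_odd_le. }
  induction N as [|N IH].
  - rewrite sum_O. specialize (Ht 0%nat). rewrite INR_1. lra.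
  - rewrite sum_Sn. change (@plus _ ?a ?b) with (a + b).
    eapply Rle_trans; [apply Rabs_triang|].
    specialize (Ht (S N)). rewrite (S_INR (S N)). lra.
Qed.

Definition leibniz_error (N : nat) : R := Rabs (sine_sum N (PI / 2) - PI / 4).

Lemma sin_odd_PI2 (n : nat) : sin (odd_number n * (PI / 2)) = (-1) ^ n.
Proof.
  induction n as [|n IH].
  - unfold odd_number. simpl. rewrite Rmult_1_l. apply sin_PI2.
  - rewrite odd_number_S.
    replace ((odd_number n + 2) * (PI / 2)) with (odd_number n * (PI / 2) + PI) by field.
    rewrite neg_sin, IH. simpl. ring.
Qed.

(** At [PI / 2] the sine sum is the alternating series of Leibniz, whose
    partial sums enclose [PI / 4]. *)
Lemma leibniz_error_le (N : nat) : leibniz_error N <= / odd_number N.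
Proof.
  unfold leibniz_error, sine_sum.
  rewrite (sum_n_ext _ (tg_alt PI_tg)).
  2:{ intros n. rewrite sin_odd_PI2. reflexivity. }
  rewrite sum_n_Reals.
  assert (Hodd : forall n, tg_alt PI_tg (2 * n) = / odd_number (2 * n)).
  { intros n. unfold tg_alt, PI_tg. rewrite pow_1_even. unfold odd_number. ring. }
  assert (Hev : forall n, tg_alt PI_tg (S (2 * n)) = - / odd_number (S (2 * n))).
  { intros n. unfold tg_alt, PI_tg. rewrite pow_1_odd. unfold odd_number. ring. }
  destruct (Nat.Even_or_Odd N) as [[k ->]|[k ->]].
  - pose proof (Alt_PI_ineq k) as H. rewrite Alt_PI_eq in H.
    simpl sum_f_R0 in H at 1.
    replace (k + (k + 0))%nat with (2 * k)%nat in H by lia.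
    rewrite Hev in H.
    pose proof (odd_number_pos (2 * k)) as Hp. rewrite odd_number_S in *.
    apply Rabs_le. split.
    + pose proof (Rinv_0_lt_compat _ Hp). lra.
    + assert (/ (odd_number (2 * k) + 2) < / odd_number (2 * k)).
      { apply Rinv_lt_contravar; [apply Rmult_lt_0_compat|]; lra. }
      lra.
  - pose proof (Alt_PI_ineq k) as H. rewrite Alt_PI_eq in H.
    replace (2 * k + 1)%nat with (S (2 * k)) by lia.
    pose proof (Alt_PI_ineq (S k)) as H'. rewrite Alt_PI_eq in H'.
    replace (2 * S k)%nat with (S (S (2 * k))) in H' by lia.
    simpl sum_f_R0 in H' at 2.
    replace (k + (k + 0))%nat with (2 * k)%nat in H' by lia.
    assert (He : tg_alt PI_tg (S (S (2 * k))) = / odd_number (S (S (2 * k)))).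
    { replace (S (S (2 * k))) with (2 * S k)%nat by lia. apply Hodd. }
    rewrite He, (odd_number_S (S (2 * k))) in H'.
    pose proof (odd_number_pos (S (2 * k))) as Hp.
    assert (/ (odd_number (S (2 * k)) + 2) < / odd_number (S (2 * k))).
    { apply Rinv_lt_contravar; [apply Rmult_lt_0_compat|]; lra. }
    pose proof (Rinv_0_lt_compat _ Hp).
    simpl sum_f_R0 in *.
    replace (k + (k + 0))%nat with (2 * k)%nat in * by lia.
    apply Rabs_le. lra.
Qed.

(** * Uniform approximation of the triangle wave *)

Lemma mvt_bound (f df : R -> R) (a b K : R) :
  a <= b ->
  (forall x, a <= x <= b -> is_derive f x (df x)) ->
  (forall x, a <= x <= b -> Rabs (df x) <= K) ->
  Rabs (f b - f a) <= K * (b - a).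
Proof.
  intros Hab Hd HK.
  destruct (MVT_gen f a b df) as [c [Hc Heq]];
    rewrite ?Rmin_left, ?Rmax_right in * by lra.
  - intros x Hx. apply Hd. lra.
  - intros x Hx. apply derivable_continuous_pt.
    exists (df x). apply is_derive_Reals, Hd, Hx.
  - rewrite Heq, Rabs_mult, (Rabs_right (b - a)) by lra.
    apply Rmult_le_compat_r; [lra | now apply HK].
Qed.

(** The correction is a primitive of minus the oscillating kernel
    [sin (2 M x) / (2 sin x)], up to the variation of [1 / sin x]: the kernel
    cancels, and for [c = 1] or [c = -1] the remaining derivative has a constant
    sign on [(0, PI / 2)].  This replaces an integration by parts. *)
Lemma is_derive_corrected_sine_sum (N : nat) (c x : R) :
  0 < sin x ->
  is_derive
    (fun t => sine_sum N t
              + (cos (2 * INR (S N) * t) + c) / (4 * INR (S N) * sin t)) x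
    (- (cos (2 * INR (S N) * x) + c) * cos x / (4 * INR (S N) * sin x ^ 2)).
Proof.
  intros Hs. assert (HM : 0 < INR (S N)) by (apply lt_0_INR; lia).
  pose proof (is_derive_sine_sum N x) as HF.
  pose proof (sin_mult_dirichlet_kernel N x) as HD.
  set (M := INR (S N)) in *.
  assert (Hq : is_derive (fun t => (cos (2 * M * t) + c) / (4 * M * sin t)) x
            ((- 2 * M * sin (2 * M * x) * sin x
              - (cos (2 * M * x) + c) * cos x) / (4 * M * sin x ^ 2))).
  { auto_derive.
    - apply Rgt_not_eq, Rmult_lt_0_compat; lra.
    - field. split; lra. }
  pose proof (is_derive_plus _ _ _ _ _ HF Hq) as H.
  evar_last; [exact H|].
  change (@plus _ ?a ?b) with (a + b).
  rewrite <- HD. field. split; lra.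
Qed.

(** By the mean value theorem; the increment has the sign of [- (cos d + c)]. *)
Lemma corrected_sine_sum_increment (N : nat) (c x : R) :
  0 < x <= PI / 2 ->
  exists d w, 0 <= w /\
    sine_sum N (PI / 2) + (cos (2 * INR (S N) * (PI / 2)) + c) / (4 * INR (S N))
    - (sine_sum N x + (cos (2 * INR (S N) * x) + c) / (4 * INR (S N) * sin x))
    = - (cos d + c) * w.
Proof.
  intros Hx. pose proof PI_RGT_0.
  assert (HM : 0 < INR (S N)) by (apply lt_0_INR; lia).
  assert (Hs : forall t, x <= t <= PI / 2 -> 0 < sin t)
    by (intros; apply sin_gt_0; lra).
  destruct (MVT_gen
    (fun t => sine_sum N t
              + (cos (2 * INR (S N) * t) + c) / (4 * INR (S N) * sin t))
    x (PI / 2)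
    (fun t => - (cos (2 * INR (S N) * t) + c) * cos t
              / (4 * INR (S N) * sin t ^ 2)))
    as [d [Hd Heq]]; rewrite ?Rmin_left, ?Rmax_right in * by lra.
  - intros t Ht. apply is_derive_corrected_sine_sum, Hs. lra.
  - intros t Ht. apply derivable_continuous_pt.
    eexists. apply is_derive_Reals, is_derive_corrected_sine_sum, Hs, Ht.
  - exists (2 * INR (S N) * d),
      (cos d / (4 * INR (S N) * sin d ^ 2) * (PI / 2 - x)).
    split.
    + apply Rmult_le_pos; [|lra].
      apply Rdiv_le_0_compat; [apply cos_ge_0; lra|].
      apply Rmult_lt_0_compat; [lra | apply pow_lt, Hs, Hd].
    + rewrite sin_PI2, (Rmult_1_r (4 * INR (S N))) in Heq. rewrite Heq.
      unfold Rdiv. ring.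
Qed.

Lemma sine_sum_minus_middle (N : nat) (x : R) :
  0 < x <= PI / 2 ->
  Rabs (sine_sum N x - sine_sum N (PI / 2)) <= / (2 * INR (S N) * sin x).
Proof.
  intros Hx. pose proof PI_RGT_0.
  assert (HM : 0 < INR (S N)) by (apply lt_0_INR; lia).
  assert (Hs : 0 < sin x) by (apply sin_gt_0; lra).
  replace (/ (2 * INR (S N) * sin x)) with (2 / (4 * INR (S N) * sin x))
    by (field; lra).
  (* [c = 1] gives the lower bound and [c = -1] the upper one. *)
  destruct (corrected_sine_sum_increment N 1 x Hx) as [d [w [Hw Heq]]].
  destruct (corrected_sine_sum_increment N (-1) x Hx) as [d' [w' [Hw' Heq']]].
  unfold Rdiv in *.
  assert (H1 : 0 < / (4 * INR (S N))) by (apply Rinv_0_lt_compat; lra).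
  assert (H2 : 0 < / (4 * INR (S N) * sin x))
    by (apply Rinv_0_lt_compat, Rmult_lt_0_compat; lra).
  pose proof (COS_bound (2 * INR (S N) * x)).
  pose proof (COS_bound (2 * INR (S N) * (PI * / 2))).
  pose proof (COS_bound d). pose proof (COS_bound d').
  apply Rabs_le; split; nra.
Qed.

Lemma sine_sum_estimate (N : nat) (x : R) :
  0 < x < PI ->
  Rabs (sine_sum N x - PI / 4)
  <= leibniz_error N + / (2 * INR (S N) * sin x).
Proof.
  intros Hx.
  assert (H : Rabs (sine_sum N x - sine_sum N (PI / 2))
              <= / (2 * INR (S N) * sin x)).
  { destruct (Rle_dec x (PI / 2)) as [Hle|Hgt].
    - apply sine_sum_minus_middle. lra.
    - rewrite <- (sine_sum_reflect N x), <- (sin_PI_x x).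
      apply sine_sum_minus_middle. lra. }
  unfold leibniz_error.
  replace (sine_sum N x - PI / 4)
    with ((sine_sum N x - sine_sum N (PI / 2)) + (sine_sum N (PI / 2) - PI / 4))
    by ring.
  eapply Rle_trans; [apply Rabs_triang | lra].
Qed.

Lemma leibniz_error_le_1 (N : nat) : leibniz_error N <= 1.
Proof.
  eapply Rle_trans; [apply leibniz_error_le|].
  rewrite <- Rinv_1. apply Rinv_le_contravar; [lra|].
  rewrite odd_number_eq. pose proof (pos_INR N). lra.
Qed.

(** For [M sin x <= 1] the trivial bound [M sin x] on the sine sum applies,
    otherwise the error term [1 / (2 M sin x)] is at most [1 / 2]. *)
Lemma sine_sum_bounded (N : nat) (x : R) :
  0 <= x <= PI -> Rabs (sine_sum N x - PI / 4) <= 2.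
Proof.
  intros Hx. pose proof PI_4. pose proof PI_RGT_0.
  assert (HM : 0 < INR (S N)) by (apply lt_0_INR; lia).
  assert (Hs : 0 <= sin x) by (apply sin_ge_0; lra).
  destruct (Rle_dec (INR (S N) * sin x) 1) as [Hsmall|Hlarge].
  - pose proof (Rabs_sine_sum_le N x) as H1.
    rewrite (Rabs_right (sin x)) in H1 by lra.
    unfold Rminus. eapply Rle_trans; [apply Rabs_triang|].
    rewrite Rabs_Ropp, (Rabs_right (PI / 4)) by lra. lra.
  - assert (0 < x < PI).
    { split.
      - destruct (Req_dec x 0) as [->|]; [|lra].
        rewrite sin_0, Rmult_0_r in Hlarge. lra.
      - destruct (Req_dec x PI) as [->|]; [|lra].
        rewrite sin_PI, Rmult_0_r in Hlarge. lra. }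
    eapply Rle_trans; [now apply sine_sum_estimate|].
    pose proof (leibniz_error_le_1 N).
    assert (/ (2 * INR (S N) * sin x) <= 1); [|lra].
    rewrite <- Rinv_1. apply Rinv_le_contravar; lra.
Qed.

Lemma inv_INR_eventually_lt (e : R) :
  0 < e -> exists N0, forall N, (N0 <= N)%nat -> / INR (S N) < e.
Proof.
  intros He. destruct (archimed_cor1 e He) as [N0 [H1 H2]].
  exists N0. intros N HN. eapply Rle_lt_trans; [|exact H1].
  apply Rinv_le_contravar; [apply lt_0_INR; lia | apply le_INR; lia].
Qed.

Lemma sine_sum_uniformly_close (eta e : R) :
  0 < eta <= PI / 2 -> 0 < e ->
  exists N0, forall N, (N0 <= N)%nat ->
  forall x, eta <= x <= PI - eta -> Rabs (sine_sum N x - PI / 4) <= e.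
Proof.
  intros Heta He.
  assert (Hs : 0 < sin eta) by (apply sin_gt_0; lra).
  destruct (inv_INR_eventually_lt (e / (1 + / sin eta))) as [N0 HN0].
  { apply Rdiv_lt_0_compat; [lra|]. pose proof (Rinv_0_lt_compat _ Hs). lra. }
  exists N0. intros N HN x Hx. specialize (HN0 N HN).
  assert (HM : 0 < INR (S N)) by (apply lt_0_INR; lia).
  assert (Hsx : sin eta <= sin x).
  { destruct (Rle_dec x (PI / 2)).
    - apply sin_incr_1; lra.
    - rewrite <- (sin_PI_x x). apply sin_incr_1; lra. }
  eapply Rle_trans; [apply sine_sum_estimate; lra|].
  pose proof (leibniz_error_le N) as Hl.
  assert (/ odd_number N <= / INR (S N)).
  { apply Rinv_le_contravar; [lra|]. rewrite odd_number_eq, S_INR.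
    pose proof (pos_INR N). lra. }
  assert (/ (2 * INR (S N) * sin x) <= / INR (S N) * / sin eta).
  { rewrite <- Rinv_mult. apply Rinv_le_contravar; [|nra].
    apply Rmult_lt_0_compat; lra. }
  apply Rlt_div_r in HN0; [|pose proof (Rinv_0_lt_compat _ Hs); lra].
  lra.
Qed.

Definition cosine_sum_pow (j N : nat) (x : R) : R :=
  sum_n (fun n => cos (odd_number n * x) / odd_number n ^ (2 * j + 2)) N.

Definition lambda_sum (N j : nat) : R :=
  sum_n (fun n => / odd_number n ^ (2 * j + 2)) N.

Lemma cosine_sum_pow_0 (j N : nat) : cosine_sum_pow j N 0 = lambda_sum N j.
Proof.
  apply sum_n_ext. intros n. rewrite Rmult_0_r, cos_0. apply Rmult_1_l.
Qed.

Lemma is_derive_cosine_sum_pow_0 (N : nat) (x : R) :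
  is_derive (cosine_sum_pow 0 N) x (- sine_sum N x).
Proof.
  evar_last.
  - apply (is_derive_sum_n (K := R_AbsRing) (V := R_NormedModule) _ _ _
             (fun n => - (sin (odd_number n * x) / odd_number n))).
    intros k _. pose proof (odd_number_pos k). auto_derive; [exact I|].
    simpl. field. lra.
  - change (@eq R (sum_n (fun n => - (sin (odd_number n * x) / odd_number n)) N)
              (- sine_sum N x)).
    unfold sine_sum. induction N as [|N IH]; [now rewrite !sum_O|].
    rewrite !sum_Sn. change (@plus _ ?a ?b) with (a + b) in *.
    rewrite IH. ring.
Qed.

(** The deviation of the [N]-th partial sums from the equality
    [sum of cos (a x) / a ^ 2 = lambda_0 - PI x / 4]. *)
Definition triangle_defect (N : nat) (x : R) : R :=
  lambda_sum N 0 - PI / 4 * x - cosine_sum_pow 0 N x.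

Lemma is_derive_triangle_defect (N : nat) (x : R) :
  is_derive (triangle_defect N) x (sine_sum N x - PI / 4).
Proof.
  unfold triangle_defect.
  assert (H : is_derive (fun t => lambda_sum N 0 - PI / 4 * t) x (- (PI / 4)))
    by (auto_derive; [exact I | ring]).
  pose proof (is_derive_minus _ _ _ _ _ H (is_derive_cosine_sum_pow_0 N x)) as H'.
  evar_last; [exact H'|].
  change (- (PI / 4) - - sine_sum N x = sine_sum N x - PI / 4).
  ring.
Qed.

(** The derivative of the defect is small away from the endpoints and bounded
    near them, so its integral from [0] is small everywhere.  With the margin
    [eta <= e / 8], each of the two end pieces contributes at most [e / 4] and
    the middle one at most [PI e / 8 <= e / 2]. *)
Lemma triangle_defect_uniformly_small (e : R) :
  0 < e ->
  exists N0, forall N, (N0 <= N)%nat ->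
  forall x, 0 <= x <= PI -> Rabs (triangle_defect N x) <= e.
Proof.
  intros He. pose proof PI_RGT_0. pose proof PI2_3_2.
  set (eta := Rmin (e / 8) 1).
  assert (Heta : 0 < eta <= e / 8 /\ eta <= 1).
  { unfold eta. repeat split; [apply Rmin_pos; lra | apply Rmin_l | apply Rmin_r]. }
  destruct (sine_sum_uniformly_close eta (e / 8)) as [N0 HN0]; [lra | lra |].
  exists N0. intros N HN x Hx. specialize (HN0 N HN).
  set (r := triangle_defect N).
  assert (Hr0 : r 0 = 0).
  { unfold r, triangle_defect. rewrite cosine_sum_pow_0. ring. }
  assert (Hcrude : forall a b, 0 <= a -> a <= b -> b <= PI ->
            Rabs (r b - r a) <= 2 * (b - a)).
  { intros a b Ha Hab Hb.
    apply (mvt_bound r (fun t => sine_sum N t - PI / 4)); [exact Hab| |].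
    - intros t _. apply is_derive_triangle_defect.
    - intros t Ht. apply sine_sum_bounded. lra. }
  assert (Hfine : forall b, eta <= b <= PI - eta ->
            Rabs (r b - r eta) <= e / 8 * (b - eta)).
  { intros b Hb.
    apply (mvt_bound r (fun t => sine_sum N t - PI / 4)); [lra| |].
    - intros t _. apply is_derive_triangle_defect.
    - intros t Ht. apply HN0. lra. }
  pose proof PI_4 as Hpi4.
  destruct (Rle_dec x eta) as [Hle|Hgt].
  - pose proof (Hcrude 0 x). rewrite Hr0, !Rminus_0_r in *. lra.
  - pose proof (Hcrude 0 eta). rewrite Hr0, !Rminus_0_r in *.
    assert (Hc : exists c, eta <= c <= PI - eta /\ c <= x <= c + eta).
    { destruct (Rle_dec x (PI - eta)); [exists x | exists (PI - eta)]; lra. }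
    destruct Hc as [c [Hc Hcx]].
    pose proof (Hfine c Hc) as Hf. pose proof (Hcrude c x) as Hg.
    assert (e / 8 * (c - eta) <= e / 8 * 4) by (apply Rmult_le_compat_l; lra).
    replace (r x) with (r eta + (r c - r eta) + (r x - r c)) by ring.
    eapply Rle_trans; [apply Rabs_triang|].
    eapply Rle_trans; [apply Rplus_le_compat_r, Rabs_triang|]. lra.
Qed.

(** * Repeated integration and the recurrence at [PI] *)

Definition divided_power (n : nat) (x : R) : R := x ^ n / INR (fact n).

Lemma is_derive_divided_power (n : nat) (x : R) :
  is_derive (divided_power (S n)) x (divided_power n x).
Proof.
  unfold divided_power. auto_derive; [exact I|].
  change (fact n + n * fact n)%nat with (fact (S n)).
  rewrite fact_simpl, mult_INR.
  change (match n with O => 1 | S _ => INR n + 1 end) with (INR (S n)).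
  field. split; [apply INR_fact_neq_0 | apply not_0_INR; lia].
Qed.

Lemma divided_power_S_0 (n : nat) : divided_power (S n) 0 = 0.
Proof. unfold divided_power. simpl. unfold Rdiv. ring. Qed.

(** Starting from [L 0 - PI x / 4], replace a function [J] times by the next
    constant [L 1], ..., [L J] minus its double integral from [0]: the result is
    [lambda_poly 0 L J].  The index [s] counts further integrations from [0]. *)
Definition lambda_poly (s : nat) (L : nat -> R) (J : nat) (x : R) : R :=
  sum_n (fun i => (-1) ^ i * L (J - i)%nat * divided_power (2 * i + s) x) J
  + (-1) ^ S J * (PI / 4) * divided_power (2 * J + 1 + s) x.

Lemma is_derive_lambda_poly (s : nat) (L : nat -> R) (J : nat) (x : R) :
  is_derive (lambda_poly (S s) L J) x (lambda_poly s L J x).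
Proof.
  apply (is_derive_plus (K := R_AbsRing) (V := R_NormedModule)).
  - apply (is_derive_sum_n (K := R_AbsRing) (V := R_NormedModule)).
    intros i _. rewrite Nat.add_succ_r.
    apply is_derive_scal, is_derive_divided_power.
  - rewrite Nat.add_succ_r. apply is_derive_scal, is_derive_divided_power.
Qed.

(** With [is_derive_lambda_poly], this makes [- lambda_poly 1 L J] the derivative
    of [lambda_poly 0 L (S J)], in step with the derivatives of the cosine sums. *)
Lemma lambda_poly_0_S (L : nat -> R) (J : nat) (x : R) :
  lambda_poly 0 L (S J) x = L (S J) - lambda_poly 2 L J x.
Proof.
  unfold lambda_poly.
  replace (sum_n (fun i => (-1) ^ i * L (S J - i)%nat
                           * divided_power (2 * i + 0) x) (S J))
    with (L (S J)
          - sum_n (fun i => (-1) ^ i * L (J - i)%nat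
                            * divided_power (2 * i + 2) x) J).
  - replace (2 * S J + 1 + 0)%nat with (2 * J + 1 + 2)%nat by lia.
    simpl pow. ring.
  - unfold sum_n. rewrite (sum_Sn_m _ 0 (S J)) by lia.
    rewrite <- sum_n_m_S.
    rewrite (sum_n_m_ext
      (fun i => (-1) ^ S i * L (S J - S i)%nat * divided_power (2 * S i + 0) x)
      (fun i => mult (-1) ((-1) ^ i * L (J - i)%nat
                           * divided_power (2 * i + 2) x))).
    + rewrite (sum_n_m_mult_l (K := R_Ring)).
      change (@plus _ ?a ?b) with (a + b). change (@mult _ ?a ?b) with (a * b).
      change (divided_power (2 * 0 + 0) x) with (1 / 1).
      rewrite Nat.sub_0_r, pow_O.
      (* The two sums differ in their monoid structures only. *)
      match goal with |- _ - ?s = _ + _ * ?s' => change s' with s end. field.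
    + intros i. change (@mult _ ?a ?b) with (a * b).
      replace (2 * S i + 0)%nat with (2 * i + 2)%nat by lia. simpl pow.
      change (S J - S i)%nat with (J - i)%nat.
      (* [ring] needs the equality at type [R], not at a carrier type. *)
      match goal with |- ?a = ?b => change (@eq R a b) end. ring.
Qed.

Lemma lambda_poly_S_0 (s : nat) (L : nat -> R) (J : nat) :
  lambda_poly (S s) L J 0 = 0.
Proof.
  unfold lambda_poly.
  rewrite Nat.add_succ_r, divided_power_S_0.
  rewrite (sum_n_ext _ (fun _ => zero)).
  - unfold sum_n. rewrite sum_n_m_const_zero.
    change (@zero _) with 0. ring.
  - intros i. rewrite Nat.add_succ_r, divided_power_S_0. apply Rmult_0_r.
Qed.

Definition sine_sum_pow (j N : nat) (x : R) : R :=
  sum_n (fun n => sin (odd_number n * x) / odd_number n ^ (2 * j + 3)) N.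

Lemma is_derive_sine_sum_pow (j N : nat) (x : R) :
  is_derive (sine_sum_pow j N) x (cosine_sum_pow j N x).
Proof.
  apply (is_derive_sum_n (K := R_AbsRing) (V := R_NormedModule)).
  intros k _. pose proof (odd_number_pos k).
  replace (2 * j + 3)%nat with (S (2 * j + 2)) by lia.
  assert (odd_number k ^ (2 * j + 2) <> 0) by (apply pow_nonzero; lra).
  auto_derive; [exact I|].
  simpl pow. field. split; [assumption | lra].
Qed.

Lemma is_derive_cosine_sum_pow_S (j N : nat) (x : R) :
  is_derive (cosine_sum_pow (S j) N) x (- sine_sum_pow j N x).
Proof.
  evar_last.
  - apply (is_derive_sum_n (K := R_AbsRing) (V := R_NormedModule) _ _ _
             (fun n => - (sin (odd_number n * x) / odd_number n ^ (2 * j + 3)))).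
    intros k _. pose proof (odd_number_pos k).
    replace (2 * S j + 2)%nat with (S (2 * j + 3)) by lia.
    assert (odd_number k ^ (2 * j + 3) <> 0) by (apply pow_nonzero; lra).
    auto_derive; [exact I|]. simpl pow. field. split; [assumption | lra].
  - change (@eq R
      (sum_n (fun n => - (sin (odd_number n * x) / odd_number n ^ (2 * j + 3))) N)
              (- sine_sum_pow j N x)).
    unfold sine_sum_pow. induction N as [|N IH]; [now rewrite !sum_O|].
    rewrite !sum_Sn. change (@plus _ ?a ?b) with (a + b) in *.
    rewrite IH. ring.
Qed.

Lemma sine_sum_pow_sin_0 (j N : nat) (x : R) :
  (forall n, sin (odd_number n * x) = 0) -> sine_sum_pow j N x = 0.
Proof.
  intros Hx. unfold sine_sum_pow. rewrite (sum_n_ext _ (fun _ => zero)).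
  - exact (sum_n_m_const_zero (G := R_AbelianMonoid) 0 N).
  - intros n. rewrite Hx. apply Rmult_0_l.
Qed.

Definition even_defect (J N : nat) (x : R) : R :=
  lambda_poly 0 (lambda_sum N) J x - cosine_sum_pow J N x.

Definition odd_defect (J N : nat) (x : R) : R :=
  lambda_poly 1 (lambda_sum N) J x - sine_sum_pow J N x.

Lemma is_derive_odd_defect (J N : nat) (x : R) :
  is_derive (odd_defect J N) x (even_defect J N x).
Proof.
  apply (is_derive_minus (K := R_AbsRing) (V := R_NormedModule)).
  - apply is_derive_lambda_poly.
  - apply is_derive_sine_sum_pow.
Qed.

Lemma is_derive_even_defect_S (J N : nat) (x : R) :
  is_derive (even_defect (S J) N) x (- odd_defect J N x).
Proof.
  apply (is_derive_ext (fun t => (lambda_sum N (S J) - lambda_poly 2 (lambda_sum N) J t)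
                                 - cosine_sum_pow (S J) N t)).
  { intros t. unfold even_defect. now rewrite lambda_poly_0_S. }
  evar_last.
  - apply (is_derive_minus (K := R_AbsRing) (V := R_NormedModule)).
    + apply (is_derive_minus (K := R_AbsRing) (V := R_NormedModule)).
      * apply is_derive_const.
      * apply is_derive_lambda_poly.
    + apply is_derive_cosine_sum_pow_S.
  - unfold odd_defect.
    change (0 - lambda_poly 1 (lambda_sum N) J x - - sine_sum_pow J N x
            = - (lambda_poly 1 (lambda_sum N) J x - sine_sum_pow J N x)). ring.
Qed.

Lemma odd_defect_0 (J N : nat) : odd_defect J N 0 = 0.
Proof.
  unfold odd_defect. rewrite lambda_poly_S_0, sine_sum_pow_sin_0; [ring|].
  intros n. rewrite Rmult_0_r. apply sin_0.
Qed.

Lemma even_defect_S_0 (J N : nat) : even_defect (S J) N 0 = 0.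
Proof.
  unfold even_defect. rewrite lambda_poly_0_S, lambda_poly_S_0, cosine_sum_pow_0. ring.
Qed.

Lemma even_defect_0 (N : nat) (x : R) : even_defect 0 N x = triangle_defect N x.
Proof.
  unfold even_defect, triangle_defect, lambda_poly, divided_power.
  rewrite sum_O. simpl. field.
Qed.

Lemma bound_from_0 (f df : R -> R) (K x : R) :
  f 0 = 0 -> (forall t, is_derive f t (df t)) ->
  (forall t, 0 <= t <= PI -> Rabs (df t) <= K) ->
  0 <= x <= PI -> Rabs (f x) <= K * PI.
Proof.
  intros H0 Hd HK Hx.
  pose proof (mvt_bound f df 0 x K) as H. rewrite H0, !Rminus_0_r in H.
  assert (0 <= K) by (eapply Rle_trans; [apply Rabs_pos | apply (HK x Hx)]).
  eapply Rle_trans; [apply H|].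
  - lra.
  - intros t _. apply Hd.
  - intros t Ht. apply HK. lra.
  - apply Rmult_le_compat_l; lra.
Qed.

(** In the list [even_defect 0], [odd_defect 0], [even_defect 1], ... each entry
    is up to sign the derivative of the next, and all entries vanish at [0];
    hence every step costs one factor [PI]. *)
Lemma defects_le (N : nat) (e : R) :
  (forall x, 0 <= x <= PI -> Rabs (triangle_defect N x) <= e) ->
  forall J x, 0 <= x <= PI ->
  Rabs (even_defect J N x) <= e * PI ^ (2 * J)
  /\ Rabs (odd_defect J N x) <= e * PI ^ (2 * J + 1).
Proof.
  intros He.
  assert (Hstep : forall J,
    (forall x, 0 <= x <= PI -> Rabs (even_defect J N x) <= e * PI ^ (2 * J)) ->
    (forall x, 0 <= x <= PI -> Rabs (odd_defect J N x) <= e * PI ^ (2 * J + 1))).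
  { intros J HJ x Hx. rewrite pow_add, pow_1, <- Rmult_assoc.
    apply (bound_from_0 _ (even_defect J N)); try assumption.
    - apply odd_defect_0.
    - apply is_derive_odd_defect. }
  intros J. induction J as [|J IH]; intros x Hx.
  - assert (H0 : forall x, 0 <= x <= PI -> Rabs (even_defect 0 N x) <= e * PI ^ (2 * 0)).
    { intros t Ht. rewrite even_defect_0. simpl. rewrite Rmult_1_r. now apply He. }
    split; [now apply H0 | now apply Hstep].
  - assert (HS : forall x, 0 <= x <= PI ->
              Rabs (even_defect (S J) N x) <= e * PI ^ (2 * S J)).
    { intros t Ht.
      replace (2 * S J)%nat with (2 * J + 1 + 1)%nat by lia.
      rewrite (pow_add _ (2 * J + 1)), pow_1, <- Rmult_assoc.
      apply (bound_from_0 _ (fun u => - odd_defect J N u)); [| | |exact Ht].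
      - apply even_defect_S_0.
      - apply is_derive_even_defect_S.
      - intros u Hu. rewrite Rabs_Ropp. now apply IH. }
    split; [now apply HS | now apply Hstep].
Qed.

Definition lambda_value (j : nat) : R := Series (fun n => / odd_number n ^ (2 * j + 2)).

Lemma is_lim_seq_triangle_defect_PI :
  is_lim_seq (fun N => triangle_defect N PI) 0.
Proof.
  apply is_lim_seq_spec. intros [e He]. simpl. pose proof PI_RGT_0.
  destruct (triangle_defect_uniformly_small (e / 2)) as [N0 HN0]; [lra|].
  exists N0. intros N HN. rewrite Rminus_0_r.
  eapply Rle_lt_trans; [apply HN0|]; [exact HN | lra | lra].
Qed.

Lemma cosine_sum_pow_PI (j N : nat) : cosine_sum_pow j N PI = - lambda_sum N j.
Proof.
  unfold cosine_sum_pow, lambda_sum.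
  assert (Hcos : forall n, cos (odd_number n * PI) = -1).
  { intros n. rewrite odd_number_eq.
    replace ((2 * INR n + 1) * PI) with (PI + 2 * INR n * PI) by ring.
    rewrite cos_period. apply cos_PI. }
  induction N as [|N IH].
  - rewrite !sum_O, Hcos. unfold Rdiv. ring.
  - rewrite !sum_Sn, Hcos. change (@plus _ ?a ?b) with (a + b) in *.
    rewrite IH. unfold Rdiv. ring.
Qed.

(** For [j = 0] the triangle defect at [PI] equals
    [2 * lambda_sum N 0 - PI ^ 2 / 4] and tends to [0], which gives convergence
    together with the limit [PI ^ 2 / 8]; the other cases follow by
    comparison. *)
Lemma ex_series_lambda (j : nat) : ex_series (fun n => / odd_number n ^ (2 * j + 2)).
Proof.
  assert (H0 : ex_series (fun n => / odd_number n ^ 2)).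
  { exists (PI ^ 2 / 8).
    change (is_lim_seq (fun N => lambda_sum N 0) (PI ^ 2 / 8)).
    apply (is_lim_seq_ext (fun N => / 2 * triangle_defect N PI + PI ^ 2 / 8)).
    - intros N. unfold triangle_defect. rewrite cosine_sum_pow_PI. field.
    - replace (Finite (PI ^ 2 / 8)) with (Finite (/ 2 * 0 + PI ^ 2 / 8))
        by (f_equal; ring).
      apply is_lim_seq_plus'; [|apply is_lim_seq_const].
      apply (is_lim_seq_scal_l _ (/ 2) 0). apply is_lim_seq_triangle_defect_PI. }
  apply (ex_series_le (K := R_AbsRing) (V := R_CompleteNormedModule) _
           (fun n => / odd_number n ^ 2)); [|exact H0].
  intros n. change (Rabs (/ odd_number n ^ (2 * j + 2)) <= / odd_number n ^ 2).
  pose proof (odd_number_pos n).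
  rewrite Rabs_right by (apply Rle_ge, Rlt_le, Rinv_0_lt_compat, pow_lt; lra).
  apply Rinv_le_contravar; [apply pow_lt; lra|].
  apply Rle_pow; [|lia]. rewrite odd_number_eq. pose proof (pos_INR n). lra.
Qed.

Lemma is_lim_seq_lambda_sum (j : nat) :
  is_lim_seq (fun N => lambda_sum N j) (lambda_value j).
Proof. exact (Series_correct _ (ex_series_lambda j)). Qed.

Lemma is_lim_seq_lambda_poly (s J : nat) (L : nat -> nat -> R) (l : nat -> R) (x : R) :
  (forall j, is_lim_seq (fun N => L N j) (l j)) ->
  is_lim_seq (fun N => lambda_poly s (L N) J x) (lambda_poly s l J x).
Proof.
  intros HL. apply is_lim_seq_plus'; [|apply is_lim_seq_const].
  assert (Hgen : forall k,
    is_lim_seq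
      (fun N => sum_n (fun i => (-1) ^ i * L N (J - i)%nat
                                * divided_power (2 * i + s) x) k)
      (sum_n (fun i => (-1) ^ i * l (J - i)%nat
                       * divided_power (2 * i + s) x) k)).
  { assert (Ht : forall i, is_lim_seq
      (fun N => (-1) ^ i * L N (J - i)%nat * divided_power (2 * i + s) x)
      ((-1) ^ i * l (J - i)%nat * divided_power (2 * i + s) x)).
    { intros i.
      apply (is_lim_seq_scal_r _ (divided_power (2 * i + s) x)
               (Finite ((-1) ^ i * l (J - i)%nat))).
      apply (is_lim_seq_scal_l _ ((-1) ^ i) (Finite (l (J - i)%nat))), HL. }
    intros k. induction k as [|k IH].
    - rewrite sum_O. eapply is_lim_seq_ext; [|apply Ht].
      intros N. now rewrite sum_O.
    - rewrite sum_Sn.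
      eapply is_lim_seq_ext; [|apply is_lim_seq_plus'; [exact IH | apply (Ht (S k))]].
      intros N. now rewrite sum_Sn. }
  apply Hgen.
Qed.

(** The case [alpha = 0] of the theorem, divided by [2 PI]: the trigonometric part
    of the odd defect vanishes at [PI]. *)
Lemma lambda_poly_PI (J : nat) : lambda_poly 1 lambda_value J PI = 0.
Proof.
  pose proof PI_RGT_0.
  assert (Hp : 0 < PI ^ (2 * J + 1)) by (apply pow_lt; lra).
  assert (H1 : is_lim_seq (fun N => lambda_poly 1 (lambda_sum N) J PI) 0).
  { apply is_lim_seq_spec. intros [e He]. simpl.
    destruct (triangle_defect_uniformly_small (e / 2 / PI ^ (2 * J + 1)))
      as [N0 HN0]; [apply Rdiv_lt_0_compat; lra|].
    exists N0. intros N HN.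
    destruct (defects_le N _ (HN0 N HN) J PI) as [_ Hodd]; [lra|].
    unfold odd_defect in Hodd.
    rewrite (sine_sum_pow_sin_0 J N PI sin_odd_PI) in Hodd.
    unfold Rdiv in Hodd. rewrite (Rmult_assoc (e * / 2)), Rinv_l in Hodd by lra.
    lra. }
  pose proof (is_lim_seq_lambda_poly 1 J lambda_sum lambda_value PI
                is_lim_seq_lambda_sum) as H2.
  apply is_lim_seq_unique in H1. apply is_lim_seq_unique in H2.
  rewrite H1 in H2. now injection H2.
Qed.

(** * Cauchy products of complex sequences *)

Local Open Scope C_scope.

(** A copy of [sum_n] whose type is literally [C], so that [ring] and [field]
    recognise equalities between such sums. *)
Definition Csum (f : nat -> C) (n : nat) : C := sum_n (G := C_AbelianMonoid) f n.

Lemma Csum_O (f : nat -> C) : Csum f 0 = f 0%nat.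
Proof. exact (sum_O (G := C_AbelianMonoid) f). Qed.

Lemma Csum_S (f : nat -> C) (n : nat) : Csum f (S n) = Csum f n + f (S n).
Proof. exact (sum_Sn (G := C_AbelianMonoid) f n). Qed.

Lemma Csum_ext (f g : nat -> C) (n : nat) :
  (forall k, (k <= n)%nat -> f k = g k) -> Csum f n = Csum g n.
Proof. exact (sum_n_ext_loc (G := C_AbelianMonoid) f g n). Qed.

Lemma Csum_head (f : nat -> C) (n : nat) :
  Csum f (S n) = f 0%nat + Csum (fun k => f (S k)) n.
Proof.
  induction n as [|n IH].
  - now rewrite Csum_S, !Csum_O.
  - rewrite Csum_S, IH, Csum_S. ring.
Qed.

Lemma Csum_plus (f g : nat -> C) (n : nat) :
  Csum (fun k => f k + g k) n = Csum f n + Csum g n.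
Proof. exact (sum_n_plus (G := C_AbelianMonoid) f g n). Qed.

Lemma Csum_scal (a : C) (f : nat -> C) (n : nat) :
  Csum (fun k => a * f k) n = a * Csum f n.
Proof. exact (sum_n_mult_l (K := C_Ring) a f n). Qed.

Lemma Csum_pairs (f : nat -> C) (n : nat) :
  Csum f (2 * n + 1) = Csum (fun j => f (2 * j)%nat + f (2 * j + 1)%nat) n.
Proof.
  induction n as [|n IH].
  - simpl. now rewrite Csum_S, !Csum_O.
  - replace (2 * S n + 1)%nat with (S (S (2 * n + 1))) by lia.
    rewrite !Csum_S, IH.
    replace (S (S (2 * n + 1))) with (2 * S n + 1)%nat by lia.
    replace (S (2 * n + 1)) with (2 * S n)%nat by lia. ring.
Qed.

Definition conv (a b : nat -> C) (n : nat) : C :=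
  Csum (fun j => a j * b (n - j)%nat) n.

Lemma conv_S (a b : nat -> C) (n : nat) :
  conv a b (S n) = a 0%nat * b (S n) + conv (fun j => a (S j)) b n.
Proof. unfold conv. now rewrite Csum_head. Qed.

Lemma conv_ext (a a' b b' : nat -> C) (n : nat) :
  (forall k, a k = a' k) -> (forall k, b k = b' k) -> conv a b n = conv a' b' n.
Proof. intros Ha Hb. apply Csum_ext. intros k _. now rewrite Ha, Hb. Qed.

Lemma conv_plus_l (a a' b : nat -> C) (n : nat) :
  conv (fun k => a k + a' k) b n = conv a b n + conv a' b n.
Proof.
  unfold conv. rewrite <- Csum_plus. apply Csum_ext. intros k _. ring.
Qed.

Lemma conv_scal_l (c : C) (a b : nat -> C) (n : nat) :
  conv (fun k => c * a k) b n = c * conv a b n.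
Proof.
  unfold conv. rewrite <- Csum_scal. apply Csum_ext. intros k _. ring.
Qed.

Lemma conv_scal_r (c : C) (a b : nat -> C) (n : nat) :
  conv a (fun k => c * b k) n = c * conv a b n.
Proof.
  unfold conv. rewrite <- Csum_scal. apply Csum_ext. intros k _. ring.
Qed.

(** Peeling off the head of [a], with [a] general in the induction, avoids the
    exchange of a triangular double sum. *)
Lemma conv_assoc (a b c : nat -> C) (n : nat) :
  conv (conv a b) c n = conv a (conv b c) n.
Proof.
  revert a. induction n as [|n IH]; intros a.
  - unfold conv. rewrite !Csum_O. simpl. ring.
  - rewrite !conv_S.
    rewrite (conv_ext _ (fun k => a 0%nat * b (S k) + conv (fun j => a (S j)) b k)
               c c) by (intros; rewrite ?conv_S; reflexivity).
    rewrite conv_plus_l, conv_scal_l, IH.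
    unfold conv at 1. rewrite Csum_O. simpl. ring.
Qed.

(** The shift [a -> (k + 1) a_(k+1)] is the derivation of formal power series,
    and [conv] is their product. *)
Lemma conv_Leibniz (a b : nat -> C) (n : nat) :
  RtoC (INR (S n)) * conv a b (S n)
  = conv (fun k => RtoC (INR (S k)) * a (S k)) b n
    + conv a (fun k => RtoC (INR (S k)) * b (S k)) n.
Proof.
  transitivity
    (Csum (fun j => RtoC (INR j) * a j * b (S n - j)%nat) (S n)
     + Csum (fun j => a j * (RtoC (INR (S n - j)) * b (S n - j)%nat)) (S n)).
  - unfold conv. rewrite <- Csum_scal, <- Csum_plus. apply Csum_ext.
    intros j Hj. rewrite minus_INR, RtoC_minus by lia. ring.
  - rewrite Csum_head, (Csum_S _ n), Nat.sub_diag. simpl (INR 0).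
    unfold conv.
    rewrite (Csum_ext (fun j => a j * (RtoC (INR (S n - j)) * b (S n - j)%nat))
               (fun j => a j * (RtoC (INR (S (n - j))) * b (S (n - j))))).
    + change (fun k => RtoC (INR (S k)) * a (S k) * b (S n - S k)%nat)
        with (fun k => RtoC (INR (S k)) * a (S k) * b (n - k)%nat).
      ring.
    + intros j Hj. now rewrite Nat.sub_succ_l by lia.
Qed.

(** * Differences of divided powers *)

Definition Cdivpow (n : nat) (x : C) : C := x ^ n / RtoC (INR (fact n)).

Lemma RtoC_fact_neq_0 (n : nat) : RtoC (INR (fact n)) <> 0.
Proof. intros H. apply (INR_fact_neq_0 n). now injection H. Qed.

Lemma RtoC_INR_S_neq_0 (n : nat) : RtoC (INR (S n)) <> 0.
Proof. intros H. apply (not_0_INR (S n)); [lia|]. now injection H. Qed.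

Lemma Cdivpow_S (n : nat) (x : C) : RtoC (INR (S n)) * Cdivpow (S n) x = x * Cdivpow n x.
Proof.
  unfold Cdivpow. rewrite fact_simpl, mult_INR, RtoC_mult, Cpow_S. field.
  split; [apply RtoC_fact_neq_0 | apply RtoC_INR_S_neq_0].
Qed.

(** The binomial theorem.  Both sides satisfy
    [(n + 1) u_(n+1) = (x + y) u_n], by the product rule on the right. *)
Lemma Cdivpow_plus (n : nat) (x y : C) :
  Cdivpow n (x + y) = conv (fun k => Cdivpow k x) (fun k => Cdivpow k y) n.
Proof.
  induction n as [|n IH].
  - unfold conv. rewrite Csum_O. unfold Cdivpow. simpl. field.
  - assert (H : RtoC (INR (S n)) * Cdivpow (S n) (x + y)
       = RtoC (INR (S n)) * conv (fun k => Cdivpow k x) (fun k => Cdivpow k y) (S n)).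
    { rewrite conv_Leibniz, Cdivpow_S, IH.
      rewrite (conv_ext (fun k => RtoC (INR (S k)) * Cdivpow (S k) x)
                 (fun k => x * Cdivpow k x) (fun k => Cdivpow k y) (fun k => Cdivpow k y))
        by (intros; rewrite ?Cdivpow_S; reflexivity).
      rewrite (conv_ext (fun k => Cdivpow k x) (fun k => Cdivpow k x)
                 (fun k => RtoC (INR (S k)) * Cdivpow (S k) y)
                 (fun k => y * Cdivpow k y))
        by (intros; rewrite ?Cdivpow_S; reflexivity).
      rewrite conv_scal_l, conv_scal_r. ring. }
    apply (f_equal (Cmult (/ RtoC (INR (S n))))) in H.
    rewrite !Cmult_assoc, !Cinv_l, !Cmult_1_l in H by apply RtoC_INR_S_neq_0.
    exact H.
Qed.

Lemma RtoC_m1 : RtoC (-1) = - RtoC 1.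
Proof. exact (RtoC_opp 1). Qed.

Lemma Cpow_m1_even (n : nat) : RtoC (-1) ^ (2 * n) = 1.
Proof. rewrite <- RtoC_pow, pow_1_even. reflexivity. Qed.

Lemma Cdivpow_m1_even (n : nat) : Cdivpow (2 * n) (-1) = Cdivpow (2 * n) 1.
Proof. unfold Cdivpow. now rewrite Cpow_m1_even, Cpow_1_l. Qed.

Lemma Cdivpow_m1_odd (n : nat) : Cdivpow (2 * n + 1) (-1) = - Cdivpow (2 * n + 1) 1.
Proof.
  unfold Cdivpow. rewrite Cpow_add_r, Cpow_m1_even, Cpow_1_l, Cpow_1_r.
  rewrite RtoC_m1. field. apply RtoC_fact_neq_0.
Qed.

(** Expanding at [1] and at [-1], the terms with an even divided power of [1]
    cancel and the others double. *)
Lemma Cdivpow_central_difference (i : nat) (x : C) :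
  Cdivpow (2 * i + 1) (x + 1) - Cdivpow (2 * i + 1) (x - 1)
  = 2 * conv (fun j => Cdivpow (2 * j) x) (fun k => Cdivpow (2 * k + 1) 1) i.
Proof.
  replace (x - 1) with (x + RtoC (-1)) by (rewrite RtoC_m1; reflexivity).
  rewrite !Cdivpow_plus. unfold conv. rewrite !Csum_pairs, <- Csum_scal.
  match goal with |- ?a - ?b = _ => transitivity (a + RtoC (-1) * b) end.
  { rewrite RtoC_m1. ring. }
  rewrite <- Csum_scal, <- Csum_plus. apply Csum_ext. intros j Hj.
  replace (2 * i + 1 - 2 * j)%nat with (2 * (i - j) + 1)%nat by lia.
  replace (2 * i + 1 - (2 * j + 1))%nat with (2 * (i - j))%nat by lia.
  rewrite Cdivpow_m1_even, Cdivpow_m1_odd, RtoC_m1. ring.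
Qed.

(** Now the odd divided powers of [1] cancel, and the term [2 * Cdivpow _ x]
    removes the divided power of [1] of index [0]. *)
Lemma Cdivpow_second_difference (i : nat) (x : C) :
  Cdivpow (2 * i + 2) (x - 1) + Cdivpow (2 * i + 2) (x + 1) - 2 * Cdivpow (2 * i + 2) x
  = 2 * conv (fun j => Cdivpow (2 * j) x) (fun k => Cdivpow (2 * k + 2) 1) i.
Proof.
  replace (x - 1) with (x + RtoC (-1)) by (rewrite RtoC_m1; reflexivity).
  rewrite !Cdivpow_plus. unfold conv.
  replace (2 * i + 2)%nat with (S (2 * i + 1)) by lia.
  rewrite !Csum_S, !Csum_pairs, <- Csum_scal, !Nat.sub_diag.
  assert (H0 : forall y, Cdivpow 0 y = 1).
  { intros y. unfold Cdivpow. simpl. field. }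
  rewrite !H0.
  match goal with
  | |- ?a + _ + (?b + _) - _ = ?c => transitivity (a + b); [ring|]
  end.
  rewrite <- Csum_plus. apply Csum_ext. intros j Hj.
  replace (S (2 * i + 1) - 2 * j)%nat with (2 * (i - j + 1))%nat by lia.
  replace (S (2 * i + 1) - (2 * j + 1))%nat with (2 * (i - j) + 1)%nat by lia.
  replace (2 * (i - j) + 2)%nat with (2 * (i - j + 1))%nat by lia.
  rewrite Cdivpow_m1_even, Cdivpow_m1_odd. ring.
Qed.

(** * From the recurrence to the polynomial identity *)

Lemma RtoC_sum_n (f : nat -> R) (n : nat) :
  RtoC (sum_n f n) = Csum (fun k => RtoC (f k)) n.
Proof.
  induction n as [|n IH].
  - now rewrite sum_O, Csum_O.
  - rewrite sum_Sn, Csum_S, <- IH, <- RtoC_plus. reflexivity.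
Qed.

Lemma lambda_recurrence (J : nat) :
  conv (fun i => RtoC (-1) ^ i * RtoC PI ^ (2 * i + 2) * Cdivpow (2 * i + 1) 1)
    (fun k => RtoC (lambda_value k)) J
  = RtoC (-1) ^ J * RtoC PI ^ (2 * J + 4) / 4 * Cdivpow (2 * J + 2) 1.
Proof.
  pose proof (lambda_poly_PI J) as H. unfold lambda_poly in H.
  apply (f_equal RtoC) in H. rewrite RtoC_plus, RtoC_sum_n in H.
  apply (f_equal (Cmult (RtoC PI))) in H.
  rewrite Cmult_plus_distr_l, <- Csum_scal, Cmult_0_r in H.
  assert (Hf : forall n, INR (fact n) <> 0%R) by (intros; apply INR_fact_neq_0).
  unfold conv.
  rewrite (Csum_ext _ (fun k => RtoC PI *
      RtoC ((-1) ^ k * lambda_value (J - k) * divided_power (2 * k + 1) PI))).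
  - match type of H with ?a + ?b = _ => transitivity (- b + (a + b)); [ring|] end.
    rewrite H. unfold divided_power, Cdivpow.
    replace (2 * J + 1 + 1)%nat with (2 * J + 2)%nat by lia.
    replace (2 * J + 4)%nat with (S (S (2 * J + 2))) by lia.
    rewrite <- !RtoC_pow, pow1, <- !RtoC_mult.
    rewrite <- (RtoC_div 1) by apply Hf.
    rewrite <- RtoC_div by lra.
    rewrite <- !RtoC_mult, <- RtoC_opp, <- RtoC_plus.
    f_equal. simpl pow. field. apply Hf.
  - intros k Hk. unfold divided_power, Cdivpow.
    replace (2 * k + 2)%nat with (S (2 * k + 1)) by lia.
    rewrite <- !RtoC_pow, pow1, <- RtoC_div by apply Hf.
    rewrite <- !RtoC_mult.
    f_equal. simpl pow. field. apply Hf.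
Qed.

(** With [c], [s], [l], [t] the sequences of the proof, [lambda_recurrence] says
    that [s * l = t] for Cauchy products.  The sum is [2 (c * s) * l], which is
    [2 c * (s * l) = 2 c * t], and the first term is [- 2 c * t]. *)
Lemma lambda_polynomial_identity (n : nat) (x : C) :
  RtoC (-1) ^ S n * RtoC PI ^ (2 * n + 4) / 4
    * (Cdivpow (2 * n + 2) (x - 1) + Cdivpow (2 * n + 2) (x + 1) - 2 * Cdivpow (2 * n + 2) x)
  + Csum (fun i =>
      RtoC (-1) ^ S i * RtoC PI ^ (2 * i + 2)
      * (Cdivpow (2 * i + 1) (x - 1) - Cdivpow (2 * i + 1) (x + 1))
      * RtoC (lambda_value (n - i))) n
  = 0.
Proof.
  set (l := fun k => RtoC (lambda_value k)).
  set (c := fun j => RtoC (-1) ^ j * RtoC PI ^ (2 * j) * Cdivpow (2 * j) x).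
  set (s := fun i => RtoC (-1) ^ i * RtoC PI ^ (2 * i + 2) * Cdivpow (2 * i + 1) 1).
  set (t := fun J => RtoC (-1) ^ J * RtoC PI ^ (2 * J + 4) / 4 * Cdivpow (2 * J + 2) 1).
  rewrite (Csum_ext _ (fun i => 2 * (conv c s i * l (n - i)%nat))).
  - rewrite Csum_scal. change (Csum _ n) with (conv (conv c s) l n).
    rewrite conv_assoc,
      (conv_ext c c (conv s l) t n (fun _ => eq_refl) lambda_recurrence).
    rewrite Cdivpow_second_difference.
    match goal with
    | |- ?k * (RtoC 2 * ?d) + _ = _ => assert (E : conv c t n = - k * d)
    end.
    + unfold conv. rewrite <- Csum_scal. apply Csum_ext. intros j Hj.
      unfold c, t.
      replace (2 * n + 4)%nat with (2 * j + (2 * (n - j) + 4))%nat by lia.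
      replace (S n) with (S (j + (n - j))) by lia.
      rewrite Cpow_S, !Cpow_add_r, RtoC_m1. field.
    + rewrite E. ring.
  - intros i Hi.
    pose proof (Cdivpow_central_difference i x) as Hd.
    match type of Hd with ?a - ?b = ?d =>
      replace (b - a) with (- d) by (rewrite <- Hd; ring) end.
    assert (E : conv c s i
       = RtoC (-1) ^ i * RtoC PI ^ (2 * i + 2)
         * conv (fun j => Cdivpow (2 * j) x) (fun k => Cdivpow (2 * k + 1) 1) i).
    { unfold conv. rewrite <- Csum_scal. apply Csum_ext. intros j Hj.
      unfold c, s.
      replace (2 * i + 2)%nat with (2 * j + (2 * (i - j) + 2))%nat by lia.
      assert (Hi' : RtoC (-1) ^ i = RtoC (-1) ^ j * RtoC (-1) ^ (i - j))
        by (rewrite <- Cpow_add_r; f_equal; lia).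
      rewrite Hi', !Cpow_add_r. ring. }
    rewrite E, Cpow_S, RtoC_m1. unfold l. ring.
Qed.

Lemma Rpos_Cpower_INR (x : R) (k : nat) :
  (0 < x)%R -> Rpos_Cpower x (RtoC (INR k)) = RtoC (x ^ k).
Proof.
  intros Hx. unfold Rpos_Cpower. simpl Re. simpl Im.
  rewrite Rmult_0_l, cos_0, sin_0, Rmult_1_r, Rmult_0_r.
  change (exp (INR k * ln x)) with (Rpower x (INR k)).
  now rewrite Rpower_pow.
Qed.

(** The partial sums of the complex series are real, so it converges to the
    real value, and [iota] returns the only limit. *)
Lemma dirichlet_lambda_even (j : nat) :
  dirichlet_lambda (RtoC (INR (2 * j + 2))) = RtoC (lambda_value j).
Proof.
  apply (iota_filterlim_locally (V := C_CompleteNormedModule) (F := eventually)).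
  apply (filterlim_ext (fun N => RtoC (lambda_sum N j))).
  - intros N. unfold lambda_sum. rewrite RtoC_sum_n. apply Csum_ext.
    intros n _. pose proof (odd_number_pos n) as Hn. fold (odd_number n).
    rewrite Rpos_Cpower_INR by exact Hn.
    rewrite RtoC_inv by (apply pow_nonzero; lra).
    unfold Cdiv. now rewrite Cmult_1_l.
  - eapply filterlim_comp; [apply is_lim_seq_lambda_sum|].
    intros P [e He]. exists e. intros y Hy. apply He.
    split; [exact Hy | apply ball_center].
Qed.

Theorem theorem1p8 :
  forall (m : nat) (alpha : C), (1 <= m)%nat ->
  (RtoC (-1) ^ m * (RtoC PI ^ (2 * m + 2) / (RtoC 4 * RtoC (INR (fact (2 * m)))))
     * ((alpha - 1) ^ (2 * m) + (alpha + 1) ^ (2 * m) - 2 * alpha ^ (2 * m))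
   + sum_n_m (G := C_AbelianMonoid)
       (fun k : nat =>
          RtoC (-1) ^ k
          * ((alpha - 1) ^ (2 * k - 1) - (alpha + 1) ^ (2 * k - 1))
          * (RtoC PI ^ (2 * k) / RtoC (INR (fact (2 * k - 1))))
          * dirichlet_lambda (RtoC (INR (2 * m - 2 * k + 2)))) 1 m
   = 0)%C.
Proof.
  intros [|n] alpha Hm; [lia|].
  rewrite <- (lambda_polynomial_identity n alpha).
  f_equal.
  - replace (2 * S n)%nat with (2 * n + 2)%nat by lia.
    replace (2 * n + 2 + 2)%nat with (2 * n + 4)%nat by lia.
    unfold Cdivpow. field. apply RtoC_fact_neq_0.
  - rewrite <- sum_n_m_S. apply Csum_ext. intros i Hi.
    replace (2 * S n - 2 * S i + 2)%nat with (2 * (n - i) + 2)%nat by lia.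
    rewrite dirichlet_lambda_even.
    replace (2 * S i - 1)%nat with (2 * i + 1)%nat by lia.
    replace (2 * S i)%nat with (2 * i + 2)%nat by lia.
    unfold Cdivpow. field. apply RtoC_fact_neq_0.
Qed.
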